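(* Let $\Omega\subset\mathbb{R}^n$ be a strongly convex domain and let $F=F(x,y)$ be the Funk metric on $\Omega$. Then the spray $$\tilde{\mathbf G} := y^i\frac{\partial}{\partial x^i} - 2F\,y^i\frac{\partial}{\partial y^i}$$ on $\Omega$ is R-flat, i.e. its Riemann curvature vanishes identically.
   Context: Summation over repeated indices is understood; $(x,y)=(x^i,y^i)$ are the standard coordinates on $T\Omega=\Omega\times\mathbb{R}^n$. A Minkowski norm on a finite-dimensional real vector space $V$ is a nonnegative function $\varphi$ on $V$ such that (a) $\varphi(\lambda y)=\lambda\varphi(y)$ for all $\lambda>0$, $y\in V$; (b) $\varphi$ is $C^\infty$ on $V\setminus\{0\}$ and for every $y\in V\setminus\{0\}$ the symmetric bilinear form $g_y(u,v)=\frac12\frac{\partial^2}{\partial s\,\partial t}[\varphi^2(y+su+tv)]|_{s=t=0}$ is positive definite. A domain $\Omega\subset\mathbb{R}^n$ is strongly convex if there are a point $x_o\in\Omega$ and a Minkowski norm $\varphi$ on $\mathbb{R}^n$ such that the translate of $\partial\Omega$ by $-x_o$ equals $\varphi^{-1}(1)$, i.e. $\Omega=\{x:\varphi(x-x_o)<1\}$. The Funk metric $F=F(x,y)$ on $\Omega$ is defined for $x\in\Omega$ and $y\in T_x\Omega=\mathbb{R}^n$, $y\neq0$, as the positive number $F$ with $x+\frac{y}{F}\in\partial\Omega$ (equivalently $\varphi(x-x_o+y/F)=1$), and $F(x,0)=0$. A spray on a manifold $M$ is a global vector field on $TM$ of the form $\mathbf G=y^i\frac{\partial}{\partial x^i}-2G^i(x,y)\frac{\partial}{\partial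 y^i}$ in standard local coordinates, where the $G^i$ are $C^\infty$ on $TM\setminus\{0\}$ with $G^i(x,\lambda y)=\lambda^2G^i(x,y)$ for $\lambda>0$. The Riemann curvature of $\mathbf G$ is given, at $(x,y)$ with $y\ne0$, by the coefficients $$R^i_{\ k}=2\frac{\partial G^i}{\partial x^k}-y^j\frac{\partial^2G^i}{\partial x^j\partial y^k}+2G^j\frac{\partial^2G^i}{\partial y^j\partial y^k}-\frac{\partial G^i}{\partial y^j}\frac{\partial G^j}{\partial y^k}.$$ The spray is R-flat if $R^i_{\ k}=0$ for all $i,k$. For $\tilde{\mathbf G}$ one has $G^i=F\,y^i$. *)

(* Defs.v *)
From mathcomp Require Import all_boot all_order all_algebra.
From mathcomp Require Import all_classical all_reals all_analysis.

Set Implicit Arguments.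
Unset Strict Implicit.
Unset Printing Implicit Defensive.

Import Order.TTheory GRing.Theory Num.Theory.
Import numFieldTopology.Exports numFieldNormedType.Exports.

Local Open Scope classical_set_scope.
Local Open Scope ring_scope.

Definition boundary (T : topologicalType) (A : set T) : set T :=
  closure A `\` interior A.

(* Meant for an open set A of a finite-dimensional space, where it is
   equivalent to the usual definition by partial derivatives. *)
Fixpoint Ck_on (R : realType) (V : normedModType R) (k : nat) (A : set V)
    (f : V -> R) : Prop :=
  match k with
  | 0 => forall x, A x -> {for x, continuous f}
  | k'.+1 => (forall x, A x -> differentiable f x) /\
             (forall v : V, Ck_on k' A (fun x => 'D_v f x))
  end.

Definition smooth_on (R : realType) (V : normedModType R) (A : set V)
    (f : V -> R) : Prop :=
  forall k, Ck_on k A f.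

Definition minkowski_form (R : realType) (n : nat) (phi : 'rV[R]_n -> R)
    (y u v : 'rV[R]_n) : R :=
  2^-1 *
  derive1 (fun s : R =>
    derive1 (fun t : R => phi (y + s *: u + t *: v) ^+ 2) 0) 0.

(* Symmetry and bilinearity of the form follow from smoothness. *)
Definition minkowski_norm (R : realType) (n : nat) (phi : 'rV[R]_n -> R)
    : Prop :=
  [/\ forall y, 0 <= phi y,
      forall (l : R) y, 0 < l -> phi (l *: y) = l * phi y,
      smooth_on [set y | y != 0] phi &
      forall y u, y != 0 -> u != 0 -> 0 < minkowski_form phi y u u].

(* As Omega is open, connected and contains xo, the condition on its boundary
   says that Omega = [set x | phi (x - xo) < 1]. *)
Definition strongly_convex_domain (R : realType) (n : nat)
    (Omega : set 'rV[R]_n) : Prop :=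
  [/\ open Omega, connected Omega &
      exists (xo : 'rV[R]_n) (phi : 'rV[R]_n -> R),
        [/\ Omega xo, minkowski_norm phi &
            [set x - xo | x in boundary Omega] = phi @^-1` [set 1]]].

(* On a strongly convex domain Omega, for x in Omega and y != 0, there is
   exactly one such f, so that the default value of xget is not used. *)
Definition funk_metric (R : realType) (n : nat) (Omega : set 'rV[R]_n)
    (x y : 'rV[R]_n) : R :=
  if y == 0 then 0
  else xget 0 [set f : R | 0 < f /\ boundary Omega (x + f^-1 *: y)].

Definition slit_tangent (R : realType) (n : nat) (Omega : set 'rV[R]_n)
    : set ('rV[R]_n * 'rV[R]_n) :=
  [set z | Omega z.1 /\ z.2 != 0].

(* A vector field on T Omega = Omega * R^n maps z = (x, y) to its components
   along d/dx and d/dy; the component along d/dy^i of a spray is - 2 G^i. *)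
Definition spray_coef (R : realType) (n : nat)
    (X : 'rV[R]_n * 'rV[R]_n -> 'rV[R]_n * 'rV[R]_n) (i : 'I_n)
    (z : 'rV[R]_n * 'rV[R]_n) : R :=
  - (2^-1 * (X z).2 0 i).

Definition is_spray (R : realType) (n : nat) (Omega : set 'rV[R]_n)
    (X : 'rV[R]_n * 'rV[R]_n -> 'rV[R]_n * 'rV[R]_n) : Prop :=
  [/\ forall x y, Omega x -> (X (x, y)).1 = y,
      forall i, smooth_on (slit_tangent Omega) (spray_coef X i) &
      forall i (l : R) x y, Omega x -> 0 < l ->
        spray_coef X i (x, l *: y) = l ^+ 2 * spray_coef X i (x, y)].

Definition dx (R : realType) (n : nat) (k : 'I_n)
    (f : 'rV[R]_n * 'rV[R]_n -> R) (z : 'rV[R]_n * 'rV[R]_n) : R :=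
  'D_((delta_mx 0 k, 0) : 'rV[R]_n * 'rV[R]_n) f z.

Definition dy (R : realType) (n : nat) (k : 'I_n)
    (f : 'rV[R]_n * 'rV[R]_n -> R) (z : 'rV[R]_n * 'rV[R]_n) : R :=
  'D_((0, delta_mx 0 k) : 'rV[R]_n * 'rV[R]_n) f z.

Definition riemann_curvature (R : realType) (n : nat)
    (X : 'rV[R]_n * 'rV[R]_n -> 'rV[R]_n * 'rV[R]_n)
    (z : 'rV[R]_n * 'rV[R]_n) (i k : 'I_n) : R :=
  let G := spray_coef X in
  2 * dx k (G i) z
  - \sum_(j < n) z.2 0 j * dx j (dy k (G i)) z
  + 2 * (\sum_(j < n) G j z * dy j (dy k (G i)) z)
  - \sum_(j < n) dy j (G i) z * dy k (G j) z.

Definition R_flat (R : realType) (n : nat) (Omega : set 'rV[R]_n)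
    (X : 'rV[R]_n * 'rV[R]_n -> 'rV[R]_n * 'rV[R]_n) : Prop :=
  forall z, slit_tangent Omega z ->
    forall i k : 'I_n, riemann_curvature X z i k = 0.

Definition funk_spray (R : realType) (n : nat) (Omega : set 'rV[R]_n)
    (z : 'rV[R]_n * 'rV[R]_n) : 'rV[R]_n * 'rV[R]_n :=
  (z.2, - (2 * funk_metric Omega z.1 z.2) *: z.2).

(* Main.v *)
From HB Require Import structures.
Require Import Defs.
From mathcomp Require Import all_boot all_order all_algebra.
From mathcomp Require Import all_classical all_reals all_analysis.
From mathcomp Require Import ring lra.

Set Implicit Arguments.
Unset Strict Implicit.
Unset Printing Implicit Defensive.

Import Order.TTheory GRing.Theory Num.Theory.
Import numFieldTopology.Exports numFieldNormedType.Exports.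

Local Open Scope classical_set_scope.
Local Open Scope ring_scope.

(** Write p = x - xo, and let F be the Funk metric. Dividing by F shows that
    x + y / F lies on the boundary exactly when

      phi (F p + y) = F,

    so that F is implicitly defined by the Minkowski norm phi. Positivity of
    the fundamental form makes phi ^ 2 strictly convex along segments that
    avoid the origin, which gives dphi_q (p) <= phi p
    ([minkowski_derive_le]) and the triangle inequality. As phi p < 1 on
    Omega ([gauge_lt1], where connectedness is used), the equation has exactly
    one root for y != 0, and the derivative dphi_w (p) - 1 of
    phi (f p + y) - f with respect to f does not vanish at that root, where
    w = F p + y. Hence F is continuous, then differentiable
    ([implicit_differentiable]), with

      dF (u, v) = dphi_w (F u + v) / (1 - dphi_w (p))      ([derive_funk]).

    The right-hand side is C^k as soon as F is, so F is smooth ([funk_Ck]).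

    This formula also gives the curvature. First, dF (u, 0) = F dF (0, u)
    ([okada]). Secondly, let H be the derivative of G^i = F y^i with respect
    to y^k. The vector w is multiplied by a positive scalar when y is
    rescaled, and also when x moves along the chord in the direction y, since
    the exit point of the chord is then fixed. As dphi is invariant under
    rescaling of the base point, H is 1-homogeneous in y, and
    H (x + s y, y) = H (x, y) / (1 - s F). Hence the derivatives of H along
    (0, y) and (y, 0) are H and F H ([dy_spray_coef_fiber],
    [dy_spray_coef_geodesic]). With F_k the derivative of F with respect to
    y^k, the four terms of the curvature are therefore

      2 F F_k y^i,   - F H,   2 F H,   - (2 F F_k y^i + F H),

    and they add up to 0. *)

(** * Differentiability *)

Section Differentiability.
Variables (R : realType) (V W : normedModType R).
Implicit Types f g : V -> W.

Lemma differentiable_le f (L : {linear V -> W}) x : continuous L ->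
  (forall e, 0 < e ->
     \forall h \near 0, `|f (h + x) - f x - L h| <= e * `|h|) ->
  differentiable f x.
Proof.
move=> cL fL.
have fxL : f \o shift x = cst (f x) + L +o_ 0 id.
  apply/eqaddoP => e e0; near=> h.
  rewrite !fctE opprD addrA.
  by near: h; exact: fL.
by apply/diff_locallyP; rewrite (diff_unique cL fxL).
Unshelve. all: by end_near. Qed.

Lemma le_differentiable f x : differentiable f x ->
  forall e, 0 < e ->
    \forall h \near 0, `|f (h + x) - f x - 'd f x h| <= e * `|h|.
Proof.
move=> /diff_locallyP [_ /eqaddoP fL] e e0; near=> h.
have : `|(f \o shift x - (cst (f x) + 'd f x)) h| <= e * `|h|.
  by near: h; exact: fL.
by rewrite !fctE opprD addrA.
Unshelve. all: by end_near. Qed.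

Lemma near_eq_differentiable f g x :
  (\near x, f x = g x) -> differentiable f x -> differentiable g x.
Proof.
move=> fg df; apply: (differentiable_le (L := 'd f x)).
  exact: diff_continuous.
move=> e e0; near=> h.
rewrite -(nbhs_singleton fg).
suff <- : f (h + x) = g (h + x) by near: h; exact: le_differentiable.
near: h.
have /nbhs_ballP[d /= d0 fgd] := fg.
apply/nbhs_ballP; exists d => //= h.
rewrite -!ball_normE /= sub0r normrN => hd.
by apply: fgd; rewrite -ball_normE /= opprD addrCA subrr addr0 normrN.
Unshelve. all: by end_near. Qed.

End Differentiability.

Section Line.
Variables (R : realType) (V W : normedModType R).
Implicit Types (f : V -> W) (q v : V) (t : R).

(** The difference quotients agree as functions, which transfers both the
    existence and the value of the derivative. *)
Lemma growth_rate_line f q v t :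
  (fun h : R => h^-1 *: (((fun s : R => f (q + s *: v)) \o shift t) (h *: 1)
                         - f (q + t *: v)))
  = (fun h : R => h^-1 *: ((f \o shift (q + t *: v)) (h *: v)
                           - f (q + t *: v))).
Proof.
apply/funext => h /=; congr (_ *: (f _ - _)).
by rewrite [h%:A]mulr1 scalerDl addrCA.
Qed.

Lemma derive_line f q v t :
  'D_1 (fun s : R => f (q + s *: v)) t = 'D_v f (q + t *: v).
Proof. by rewrite /derive growth_rate_line. Qed.

Lemma is_derive_line f q v t : differentiable f (q + t *: v) ->
  is_derive t 1 (fun s : R => f (q + s *: v)) ('D_v f (q + t *: v)).
Proof.
move=> /(diff_derivable (v := v)) df; apply: DeriveDef; last exact: derive_line.
by rewrite /derivable growth_rate_line.
Qed.

Lemma cvg_line q v : (q + s *: v) @[s --> (0 : R)] --> q.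
Proof.
rewrite -[X in _ --> X]addr0 -(scale0r v).
by apply: cvgD; [exact: cvg_cst|apply: cvgZr_tmp; exact: cvg_id].
Qed.

Lemma near_neq0 q v : q != 0 -> \forall s \near (0 : R), q + s *: v != 0.
Proof.
move=> q0; apply: (@cvgr_neq0 _ _ _ (nbhs (0 : R)) _ _ q) => //.
exact: cvg_line.
Qed.

(** Computes a directional derivative from an explicit formula along a line,
    typically one provided by homogeneity. *)
Lemma near_derive_line f q v (c : R -> W) d :
  (\forall s \near 0, f (q + s *: v) = c s) -> is_derive (0 : R) 1 c d ->
  'D_v f q = d.
Proof.
move=> fc dc.
rewrite -{1}[q]addr0 -(scale0r v) -derive_line (near_eq_derive _ fc).
exact: derive_val.
Qed.

End Line.

Lemma derive_comp (R : realType) (U V W : normedModType R) (g : V -> W)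
    (w : U -> V) (x v : U) :
  differentiable w x -> differentiable g (w x) ->
  'D_v (g \o w) x = 'D_('D_v w x) g (w x).
Proof.
move=> dw dg; rewrite (deriveE v (differentiable_comp dw dg)).
by rewrite (deriveE _ dg) (deriveE _ dw) (diff_comp dw dg).
Qed.

Lemma derive_row (R : realType) n (f : 'rV[R]_n -> R) (x v : 'rV[R]_n) :
  differentiable f x -> 'D_v f x = \sum_i v 0 i * 'D_(delta_mx 0 i) f x.
Proof.
move=> df; rewrite deriveE // {1}(row_sum_delta v) linear_sum.
by apply: eq_bigr => i _; rewrite linearZ deriveE.
Qed.

Lemma differentiable_row (R : realType) (V : normedModType R) n
    (w : V -> 'rV[R]_n) x :
  (forall i, differentiable (fun x => w x 0 i) x) -> differentiable w x.
Proof.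
move=> dw; have -> : w = \sum_i (fun x => w x 0 i *: delta_mx 0 i).
  by apply/funext => y; rewrite fct_sumE -row_sum_delta.
by apply: differentiable_sum => i; exact: differentiableZl.
Qed.

(** * Calculus of C^k functions on an open set *)

Section Smooth.
Variable R : realType.

Section OneSpace.
Variables (V : normedModType R) (A : set V).
Hypothesis oA : open A.
Implicit Types (f g : V -> R) (x v : V).

Lemma near_open x (P : set V) : A x -> A `<=` P -> \near x, P x.
Proof. by move=> Ax AP; apply: filterS AP _; exact: open_nbhs_nbhs. Qed.

Lemma eq_Ck_on k f g :
  (forall x, A x -> f x = g x) -> Ck_on k A f -> Ck_on k A g.
Proof.
elim: k f g => [|k IH] f g fg /=.
  move=> cf x Ax; rewrite /prop_for /continuous_at -(fg x Ax).
  by apply: cvg_trans (cf x Ax); apply: near_eq_cvg; exact: near_open.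
move=> [df Cf]; split=> [x Ax|v].
  by apply: near_eq_differentiable (df x Ax); exact: near_open.
by apply: IH (Cf v) => x Ax; apply/near_eq_derive; exact: near_open.
Qed.

Lemma Ck_on_pred k f : Ck_on k.+1 A f -> Ck_on k A f.
Proof.
elim: k f => [|k IH] f [df Cf].
  by move=> x Ax; exact/differentiable_continuous/df.
by split => // v; exact/IH/Cf.
Qed.

Lemma Ck_on_cst k (c : R) : Ck_on k A (cst c).
Proof.
elim: k c => [|k IH] c /=; first by move=> x _; exact: cst_continuous.
split=> [x _|v]; first exact: differentiable_cst.
by apply: eq_Ck_on (IH 0) => x _; rewrite /= derive_cst.
Qed.

Lemma Ck_on_linear k (L : {linear V -> R}) :
  continuous L -> Ck_on k A L.
Proof.
move=> cL; case: k => [|k] /=; first by move=> x _; exact: cL.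
split=> [x _|v]; first exact: linear_differentiable.
apply: eq_Ck_on (Ck_on_cst k (L v)) => x _ /=.
by rewrite deriveE ?diff_lin //; exact: linear_differentiable.
Qed.

Lemma Ck_on_add k f g : Ck_on k A f -> Ck_on k A g ->
  Ck_on k A (fun x => f x + g x).
Proof.
elim: k f g => [|k IH] f g /=.
  by move=> cf cg x Ax; apply: continuousD; [exact: cf|exact: cg].
move=> [df Cf] [dg Cg]; split=> [x Ax|v].
  by apply: differentiableD; [exact: df|exact: dg].
apply: eq_Ck_on (IH _ _ (Cf v) (Cg v)) => x Ax /=.
by rewrite -deriveD //; apply: diff_derivable; [exact: df|exact: dg].
Qed.

Lemma Ck_on_mul k f g : Ck_on k A f -> Ck_on k A g ->
  Ck_on k A (fun x => f x * g x).
Proof.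
elim: k f g => [|k IH] f g.
  by move=> cf cg x Ax; apply: continuousM; [exact: cf|exact: cg].
move=> Cf Cg; have [df Df] := Cf; have [dg Dg] := Cg.
split=> [x Ax|v].
  by apply: differentiableM; [exact: df|exact: dg].
apply: eq_Ck_on (Ck_on_add (IH _ _ (Ck_on_pred Cf) (Dg v))
                           (IH _ _ (Ck_on_pred Cg) (Df v))) => x Ax /=.
rewrite -[RHS]/('D_v (f * g) x) deriveM //; apply: diff_derivable.
  exact: df.
exact: dg.
Qed.

Lemma Ck_on_opp k f : Ck_on k A f -> Ck_on k A (fun x => - f x).
Proof.
move=> Cf; apply: eq_Ck_on (Ck_on_mul (Ck_on_cst k (- 1)) Cf) => x _.
by rewrite /= mulN1r.
Qed.

Lemma Ck_on_sum k n (f : 'I_n -> V -> R) :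
  (forall i, Ck_on k A (f i)) -> Ck_on k A (fun x => \sum_i f i x).
Proof.
elim: n f => [|n IH] f Cf.
  by apply: eq_Ck_on (Ck_on_cst k 0) => x _; rewrite big_ord0.
apply: eq_Ck_on (Ck_on_add (Cf ord0) (IH _ (fun i => Cf (lift ord0 i)))) => x _.
by rewrite big_ord_recl.
Qed.

(** The derivative of 1 / f only involves 1 / f and the derivative of f, so the
    order of 1 / f can be raised one step at a time. *)
Lemma Ck_on_inv k f : (forall x, A x -> f x != 0) -> Ck_on k A f ->
  Ck_on k A (fun x => (f x)^-1).
Proof.
move=> f0; elim: k => [|k IH] Cf.
  by move=> x Ax; apply: cvgV; [exact: f0|exact: Cf].
have [df Df] := Cf; split=> [x Ax|v].
  by apply: differentiableV; [exact: df|exact: f0].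
have If := IH (Ck_on_pred Cf).
apply: eq_Ck_on (Ck_on_opp (Ck_on_mul (Ck_on_mul If If) (Df v))) => x Ax /=.
rewrite -[RHS]/('D_v (fun y => (f y)^-1) x) deriveV ?f0 //; last first.
  exact/diff_derivable/df.
by rewrite -invfM -expr2 -mulNr.
Qed.

End OneSpace.

(** The chain rule writes a derivative of g \o w as a sum of products of
    (d_i g) \o w with derivatives of the coordinates of w; the induction
    therefore runs over all g at once. *)
Lemma Ck_on_comp (V : normedModType R) n (A : set V) (B : set 'rV[R]_n) k
    (g : 'rV[R]_n -> R) (w : V -> 'rV[R]_n) :
  open A -> (forall x, A x -> B (w x)) -> Ck_on k B g ->
  (forall i, Ck_on k A (fun x => w x 0 i)) -> Ck_on k A (g \o w).
Proof.
move=> oA AB; elim: k g => [|k IH] g Cg Cw.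
  move=> x Ax; apply: continuous_comp; last exact/Cg/AB.
  have -> : w = \sum_i (fun x => w x 0 i *: delta_mx 0 i).
    by apply/funext => y; rewrite fct_sumE -row_sum_delta.
  apply: (big_ind (fun f : V -> 'rV[R]_n => {for x, continuous f})).
  - exact: cst_continuous.
  - by move=> f1 f2; exact: continuousD.
  - move=> i _; apply: cvgZr_tmp; exact: Cw.
have [dg Dg] := Cg.
have dw x : A x -> differentiable w x.
  by move=> Ax; apply: differentiable_row => i; have [+ _] := Cw i; exact.
split=> [x Ax|v].
  by apply: differentiable_comp; [exact: dw|exact/dg/AB].
apply: eq_Ck_on; first exact: oA.
  move=> x Ax; rewrite derive_comp; [|exact: dw|exact/dg/AB].
  rewrite derive_row; last exact/dg/AB.
  rewrite derive_mx; last exact/diff_derivable/dw.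
  under eq_bigr do rewrite mxE.
  reflexivity.
apply: Ck_on_sum => // i; apply: Ck_on_mul => //.
  by have [_ +] := Cw i; exact.
by apply: (IH _ (Dg _)) => j; exact/Ck_on_pred/Cw.
Qed.

End Smooth.
(** * The implicit function theorem for a continuous solution *)

(** Let b be the partial derivative of P in the last variable and A the one in
    the first. With D the increment of F, the expansion of P at (x, F x) reads
    A h + b D = o(|h| + |D|). As b != 0, this first bounds |D| by a multiple
    of |h|, and then yields D = - A h / b + o(|h|). *)
Lemma implicit_differentiable (R : realType) (V : normedModType R)
    (P : V * R -> R) (F : V -> R) (x : V) :
  {for x, continuous F} -> (\near x, P (x, F x) = 0) ->
  differentiable P (x, F x) -> 'D_(0, 1) P (x, F x) != 0 ->
  differentiable F x.
Proof.
move=> cF P0 dP; rewrite deriveE //; set dPx := 'd P (x, F x).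
set b := dPx (0, 1) => b0.
have b_gt0 : 0 < `|b| by rewrite normr_gt0.
pose L (h : V) : R := - (b^-1 * dPx (h, 0)).
have linL : linear L.
  move=> a u v; rewrite /L.
  have -> : (a *: u + v, 0) = a *: (u, 0) + (v, 0) :> V * R.
    by congr (_, _); rewrite /= scaler0 addr0.
  rewrite linearP mulrDr opprD; congr (_ + _).
  by rewrite /GRing.scale /= mulrN mulrCA.
pose LM := GRing.isLinear.Build _ _ _ _ _ linL.
pose L' : {linear V -> R} := HB.pack L LM.
have cdP : continuous dPx by exact: diff_continuous.
have cL : continuous L'.
  move=> h; apply: cvgN; apply: cvgM; first exact: cvg_cst.
  apply: (@continuous_comp _ _ _ (fun h => (h, 0) : V * R) dPx);
    last exact: cdP.
  by apply: (cvg_pair (F := nbhs h) (G := nbhs h) (H := nbhs (0 : R)));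
    [exact: cvg_id|exact: cvg_cst].
have [K K0 dPK] := linear_lipschitz cdP.
(* C bounds the candidate differential L. *)
pose C := K / `|b|.
have C0 : 0 < C by rewrite divr_gt0.
apply: (differentiable_le cL) => e e0.
(* The bound by 1 / 2 absorbs |D| into the left-hand side in r4; the other
   one turns the estimate into e |h|, as |h| + |D| <= (2 C + 2) |h|. *)
pose eta := Num.min (2^-1) (e / (2 * C + 2)).
have eta0 : 0 < eta.
  by rewrite lt_min invr_gt0 ltr0n divr_gt0 // addr_gt0 // mulr_gt0.
have etae : eta * (2 * C + 2) <= e.
  rewrite -ler_pdivlMr; last by rewrite addr_gt0 // mulr_gt0.
  by rewrite ge_min lexx orbT.
have eta2 : eta <= 2^-1 by rewrite ge_min lexx.
have shiftx : (h + x) @[h --> 0] --> x.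
  rewrite -[X in _ --> X]add0r.
  by apply: cvgD; [exact: cvg_id|exact: cvg_cst].
have Fsh : (F (h + x) - F x) @[h --> 0] --> (0 : R).
  rewrite -[X in _ --> X](subrr (F x)); apply: cvgB; last exact: cvg_cst.
  exact: (cvg_comp _ _ shiftx cF).
have ksh : ((h, F (h + x) - F x) : V * R) @[h --> 0] --> ((0 : V), (0 : R)).
  by apply: (cvg_pair (F := nbhs (0 : V)) (G := nbhs (0 : V))
    (H := nbhs (0 : R))); [exact: cvg_id|exact: Fsh].
have Peta := le_differentiable dP (mulr_gt0 b_gt0 eta0).
near=> h.
have Pk : `|P ((h, F (h + x) - F x) + (x, F x)) - P (x, F x)
             - dPx (h, F (h + x) - F x)|
          <= `|b| * eta * `|(h, F (h + x) - F x)|.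
  by near: h; exact: ksh _ Peta.
have E2 : P (h + x, F (h + x)) = 0 by near: h; exact: shiftx _ P0.
pose D := F (h + x) - F x; rewrite -/D in Pk *.
have E1 : ((h, D) : V * R) + (x, F x) = (h + x, F (h + x)).
  by congr (_, _); rewrite /= subrK.
have E3 : P (x, F x) = 0 by exact: (nbhs_singleton P0).
have E4 : dPx (h, D) = dPx (h, 0) + D * b.
  have -> : ((h, D) : V * R) = (h, 0) + D *: (0, 1).
    congr (_, _); rewrite /= ?scaler0 ?addr0 //.
    by rewrite add0r [_ *: _]mulr1.
  by rewrite linearD linearZ.
rewrite E1 E2 E3 E4 subrr sub0r normrN in Pk.
have E5 : D - L' h = b^-1 * (dPx (h, 0) + D * b).
  by rewrite /= /L opprK mulrDr addrC mulrCA mulVf // mulr1.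
have kle : `|(h, D)| <= `|h| + `|D|.
  by rewrite ge_max lerDl lerDr !normr_ge0.
have r1 : `|D - L' h| <= eta * (`|h| + `|D|).
  rewrite E5 normrM normfV -(ler_pM2l b_gt0) mulrA mulfV ?gt_eqF // mul1r.
  rewrite mulrA; apply: le_trans Pk _.
  by rewrite ler_pM2l // mulr_gt0.
have r2 : `|L' h| <= C * `|h|.
  rewrite /= /L normrN normrM normfV /C [K / _]mulrC -mulrA.
  rewrite ler_pM2l ?invr_gt0 //; apply: le_trans (dPK _) _.
  by rewrite ler_pM2l // ge_max lexx normr0 normr_ge0.
have r3 : `|D| <= `|D - L' h| + `|L' h|.
  by rewrite -{1}(subrK (L' h) D) ler_normD.
have h0 : 0 <= `|h| by [].
have D0 : 0 <= `|D| by [].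
have r4 : `|D| <= (2 * C + 1) * `|h| by nra.
by nra.
Unshelve. all: by end_near. Qed.

(** * Minkowski norms *)

Section Minkowski.
Variables (R : realType) (n : nat) (phi : 'rV[R]_n -> R).
Hypothesis mphi : minkowski_norm phi.
Implicit Types p q u v y : 'rV[R]_n.

Lemma minkowski_ge0 y : 0 <= phi y.
Proof. by have [+ _ _ _] := mphi; exact. Qed.

Lemma minkowskiZ l y : 0 < l -> phi (l *: y) = l * phi y.
Proof. by have [_ + _ _] := mphi; exact. Qed.

Lemma minkowski0 : phi 0 = 0.
Proof.
have : phi 0 = 2 * phi 0 by rewrite -minkowskiZ // scaler0.
by lra.
Qed.

Lemma minkowski_smooth k : Ck_on k [set y | y != 0] phi.
Proof. by have [_ _ + _] := mphi; exact. Qed.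

Lemma minkowski_differentiable y : y != 0 -> differentiable phi y.
Proof. by have [+ _] := minkowski_smooth 1; exact. Qed.

Lemma minkowski_derive_differentiable u y :
  y != 0 -> differentiable ('D_u phi) y.
Proof. by have [_ /(_ u) [+ _]] := minkowski_smooth 2; exact. Qed.

Lemma minkowski_deriveD y u v : y != 0 ->
  'D_(u + v) phi y = 'D_u phi y + 'D_v phi y.
Proof. by move=> /minkowski_differentiable d; rewrite !deriveE // linearD. Qed.

Lemma minkowski_deriveZ y (a : R) v : y != 0 ->
  'D_(a *: v) phi y = a * 'D_v phi y.
Proof. by move=> /minkowski_differentiable d; rewrite !deriveE // linearZ. Qed.

Lemma minkowski_euler q : q != 0 -> 'D_q phi q = phi q.
Proof.
move=> q0.
have dc : is_derive (0 : R) 1 (fun s : R => s * phi q + phi q) (phi q).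
  by apply: is_derive_eq; rewrite addr0 scaler0 add0r [_ *: _]mulr1.
apply: near_derive_line dc; near=> s.
have -> : q + s *: q = (s + 1) *: q by rewrite scalerDl scale1r addrC.
rewrite minkowskiZ ?mulrDl ?mul1r //.
by rewrite -ltrBlDr sub0r; near: s; apply: lt_nbhsr; rewrite oppr_lt0.
Unshelve. all: by end_near. Qed.

(** The differential of a 1-homogeneous function is 0-homogeneous in the base
    point. *)
Lemma minkowski_derive_scale l v q : 0 < l -> q != 0 ->
  'D_v phi (l *: q) = 'D_v phi q.
Proof.
move=> l0 q0.
have lq0 : l *: q != 0 by rewrite scaler_eq0 negb_or gt_eqF.
have dl : is_diff q ( *:%R l) ( *:%R l) by exact: is_diff_scaler.
have ddl : differentiable ( *:%R l) q by exact: ex_diff.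
have dphi := minkowski_differentiable q0.
have := derive_comp v ddl (minkowski_differentiable lq0).
rewrite (_ : phi \o *:%R l = l *: phi); last first.
  by apply/funext => y /=; rewrite minkowskiZ.
rewrite (deriveE _ ddl) diff_val minkowski_deriveZ //.
rewrite deriveZ; last exact/diff_derivable.
by move=> /(mulfI (lt0r_neq0 l0)).
Qed.

Lemma is_derive_minkowski_sqr q v t : q + t *: v != 0 ->
  is_derive t 1 (fun s => phi (q + s *: v) ^+ 2)
    (2 * phi (q + t *: v) * 'D_v phi (q + t *: v)).
Proof.
move=> qt0; have dt := is_derive_line (minkowski_differentiable qt0).
apply: is_derive_eq.
by rewrite -mulrA mulr_natl mulr2n.
Qed.

Lemma is_derive_minkowski_derive q v t : q + t *: v != 0 ->
  is_derive t 1 (fun s => 2 * phi (q + s *: v) * 'D_v phi (q + s *: v))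
    (2 * ('D_v phi (q + t *: v) ^+ 2
          + phi (q + t *: v) * 'D_v ('D_v phi) (q + t *: v))).
Proof.
move=> qt0; have dt := is_derive_line (minkowski_differentiable qt0).
have dt2 := is_derive_line (minkowski_derive_differentiable v qt0).
apply: is_derive_eq.
set a := phi _; set b := 'D_v phi _; set c := 'D_v _ _.
rewrite /GRing.scale /=; ring.
Qed.

(** Half the second derivative of phi ^ 2 along u, by the Leibniz rule. *)
Lemma minkowski_formE y u : y != 0 ->
  minkowski_form phi y u u = 'D_u phi y ^+ 2 + phi y * 'D_u ('D_u phi) y.
Proof.
move=> y0; rewrite /minkowski_form derive1E.
rewrite (@near_eq_derive _ _ _ _
  (fun s : R => 2 * phi (y + s *: u) * 'D_u phi (y + s *: u))).
  have y0' : y + 0 *: u != 0 by rewrite scale0r addr0.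
  have D := is_derive_minkowski_derive y0'.
  by rewrite derive_val scale0r addr0 mulKf.
near=> s.
have ys0 : y + s *: u + 0 *: u != 0.
  by rewrite scale0r addr0; near: s; exact: near_neq0.
have D := is_derive_minkowski_sqr ys0.
by rewrite derive1E derive_val scale0r addr0.
Unshelve. all: by end_near. Qed.

(** If phi vanished at y, Euler's relation would make the fundamental form
    vanish at (y, y). *)
Lemma minkowski_gt0 y : y != 0 -> 0 < phi y.
Proof.
move=> y0; rewrite lt_def minkowski_ge0 andbT; apply/eqP => phiy.
have [_ _ _ /(_ y y y0 y0)] := mphi.
by rewrite minkowski_formE // minkowski_euler // phiy expr0n mul0r addr0 ltxx.
Qed.

(** If the segment from q to p avoids the origin, the square h t of phi at
    q + t (p - q) has h'' > 0, so h' 0 < h 1 - h 0 < 0; and Euler's relation gives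
    h' 0 = 2 phi q (dphi_q (p) - phi q). If the segment meets the origin, then
    p is a nonpositive multiple of q and dphi_q (p) <= 0. *)
Lemma minkowski_derive_lt p q : q != 0 -> phi p < phi q -> 'D_p phi q < phi q.
Proof.
move=> q0 pq.
have phiq : 0 < phi q by apply: minkowski_gt0.
have [[t /andP[t0 t1] qt]|nz] := pselect (exists2 t : R,
    0 <= t <= 1 & q + t *: (p - q) = 0).
  have t_neq0 : t != 0.
    by apply: contra_neq q0 => t0'; rewrite t0' scale0r addr0 in qt.
  have -> : p = (- (t^-1 * (1 - t))) *: q.
    apply: (scalerI t_neq0); rewrite scalerA mulrN mulVKf //.
    apply/eqP; rewrite -subr_eq0 -qt scaleNr opprK scalerBl scale1r scalerBr.
    by apply/eqP; rewrite addrCA addrA.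
  rewrite minkowski_deriveZ // minkowski_euler // mulNr.
  apply: le_lt_trans phiq; rewrite oppr_le0 !mulr_ge0 ?invr_ge0 ?subr_ge0 //.
  exact: minkowski_ge0.
set v := p - q in nz *.
have {}nz (t : R) : 0 <= t <= 1 -> q + t *: v != 0.
  by move=> t01; apply/eqP => qt; apply: nz; exists t.
pose h (t : R) := phi (q + t *: v) ^+ 2.
pose h1 (t : R) := 2 * phi (q + t *: v) * 'D_v phi (q + t *: v).
pose h2 (t : R) := 2 * ('D_v phi (q + t *: v) ^+ 2
          + phi (q + t *: v) * 'D_v ('D_v phi) (q + t *: v)).
have dh (t : R) : 0 <= t <= 1 -> is_derive t 1 h (h1 t).
  by move=> /nz; exact: is_derive_minkowski_sqr.
have dh1 (t : R) : 0 <= t <= 1 -> is_derive t 1 h1 (h2 t).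
  by move=> /nz; exact: is_derive_minkowski_derive.
have cont (f df : R -> R) (a b : R) :
    (forall t : R, a <= t <= b -> is_derive t 1 f (df t)) ->
    {within `[a, b], continuous f}.
  move=> fd; apply: derivable_within_continuous => t; rewrite in_itv /= => tab.
  by have [] := fd t tab.
have v0 : v != 0.
  by rewrite subr_eq0; apply: contraTneq pq => ->; rewrite ltxx.
have [c] := MVT ltr01
  (fun t tI => dh t (subset_itv_oo_cc tI)) (cont _ _ _ _ dh).
rewrite in_itv /= => /andP[c0 c1] hc.
have sub t : 0 <= t <= c -> 0 <= t <= 1.
  by case/andP => -> tc; rewrite (le_trans tc) // ltW.
have [d] := MVT c0 (fun t tI => dh1 t (sub t (subset_itv_oo_cc tI)))
  (cont _ _ _ _ (fun t tI => dh1 t (sub t tI))).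
rewrite in_itv /= => /andP[d0 dc] h1c.
have h2d : 0 < h2 d.
  have qd : q + d *: v != 0 by apply: nz; lra.
  have [_ _ _ /(_ _ v qd v0)] := mphi.
  by rewrite minkowski_formE // /h2; lra.
have h0E : h 0 = phi q ^+ 2 by rewrite /h scale0r addr0.
have h1E : h 1 = phi p ^+ 2 by rewrite /h scale1r addrC subrK.
have h1E0 : h1 0 = 2 * phi q * ('D_p phi q - phi q).
  rewrite /h1 scale0r addr0 minkowski_deriveD // -scaleN1r minkowski_deriveZ //.
  by rewrite mulN1r minkowski_euler.
have p0 := minkowski_ge0 p.
have : h1 0 < 0 by nra.
rewrite h1E0; nra.
Qed.

(** The fundamental inequality, obtained by rescaling p so that phi p is just
    below phi q. *)
Lemma minkowski_derive_le p q : q != 0 -> 'D_p phi q <= phi p.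
Proof.
move=> q0; have phiq := minkowski_gt0 q0.
apply/ler_addgt0Pr => e e0.
have pe : 0 < phi p + e by rewrite ltr_wpDl ?minkowski_ge0.
pose l := phi q / (phi p + e).
have l0 : 0 < l by rewrite divr_gt0.
have : 'D_(l *: p) phi q < phi q.
  apply: minkowski_derive_lt => //; rewrite minkowskiZ //.
  by rewrite /l mulrAC ltr_pdivrMr // ltr_pM2l // ltrDl.
rewrite minkowski_deriveZ // /l mulrAC ltr_pdivrMr // ltr_pM2l //.
exact: ltW.
Qed.

(** Apply the fundamental inequality to both parts of
    phi (p + q) = dphi_(p + q) (p + q). *)
Lemma minkowski_triangle p q : phi (p + q) <= phi p + phi q.
Proof.
have [->|pq] := eqVneq (p + q) 0.
  by rewrite minkowski0 addr_ge0 ?minkowski_ge0.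
rewrite -[leLHS]minkowski_euler // minkowski_deriveD //.
by rewrite lerD // minkowski_derive_le.
Qed.

(** Gives continuity of phi at the origin, where smoothness gives nothing. *)
Lemma minkowski_bounded : exists2 C, 0 <= C & forall y, phi y <= C * `|y|.
Proof.
pose c i := phi (delta_mx 0 i) + phi (- delta_mx 0 i).
exists (\sum_i c i) => [|y].
  by apply: sumr_ge0 => i _; rewrite addr_ge0 ?minkowski_ge0.
rewrite {1}(row_sum_delta y).
have tri (s : seq 'I_n) (f : 'I_n -> 'rV[R]_n) :
    phi (\sum_(i <- s) f i) <= \sum_(i <- s) phi (f i).
  elim: s => [|i s IH]; first by rewrite !big_nil minkowski0.
  by rewrite !big_cons (le_trans (minkowski_triangle _ _)) // lerD2l.
apply: le_trans (tri _ _) _; rewrite mulr_suml; apply: ler_sum => i _.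
have yi : `|y 0 i| <= `|y|.
  by rewrite [leRHS]/Num.norm /= mx_normrE; exact: (le_bigmax _ _ (0, i)).
have cp : 0 <= phi (delta_mx 0 i) by exact: minkowski_ge0.
have cn : 0 <= phi (- delta_mx 0 i) by exact: minkowski_ge0.
apply: (@le_trans _ _ (c i * `|y 0 i|)); last first.
  by rewrite ler_wpM2l // addr_ge0.
rewrite /c; have [y0|y0|->] := ltgtP (y 0 i) 0; last first.
- by rewrite scale0r minkowski0 normr0 mulr0.
- by rewrite minkowskiZ // gtr0_norm // mulrC ler_wpM2r ?lerDl // ltW.
- rewrite -[_ *: _]opprK -scaleNr -scalerN minkowskiZ ?oppr_gt0 //.
  by rewrite ltr0_norm // mulrC ler_wpM2r ?lerDr // oppr_ge0 ltW.
Qed.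

Lemma minkowski_continuous : continuous phi.
Proof.
move=> y; have [->|y0] := eqVneq y 0; last first.
  exact/differentiable_continuous/minkowski_differentiable.
have [C C0 phiC] := minkowski_bounded.
apply/(@cvgrPdist_le _ _ _ (nbhs (0 : 'rV[R]_n))) => e e0; rewrite minkowski0.
have d0 : 0 < (C + 1)^-1 * e by rewrite mulr_gt0 // invr_gt0 ltr_wpDl.
apply: filterS (nbhsx_ballx (0 : 'rV[R]_n) _ d0) => z.
rewrite -ball_normE /= !sub0r !normrN => zd.
rewrite ger0_norm ?minkowski_ge0 //; apply: le_trans (phiC z) _.
apply: (@le_trans _ _ ((C + 1) * `|z|)); first by rewrite ler_wpM2r // lerDl.
by rewrite -ler_pdivlMl ?ltr_wpDl // ltW.
Qed.

End Minkowski.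
(** * Coordinates on the tangent bundle *)

Section Coordinates.
Variables (R : realType) (n : nat).
Local Notation rV2 := ('rV[R]_n * 'rV[R]_n)%type.

Definition fst_coord (i : 'I_n) (z : rV2) : R := z.1 0 i.
Definition snd_coord (i : 'I_n) (z : rV2) : R := z.2 0 i.

Fact fst_coord_linear i : linear (fst_coord i).
Proof. by move=> a u v; rewrite /fst_coord !mxE. Qed.
HB.instance Definition _ i :=
  GRing.isLinear.Build _ _ _ _ (fst_coord i) (fst_coord_linear i).

Fact snd_coord_linear i : linear (snd_coord i).
Proof. by move=> a u v; rewrite /snd_coord !mxE. Qed.
HB.instance Definition _ i :=
  GRing.isLinear.Build _ _ _ _ (snd_coord i) (snd_coord_linear i).

Lemma fst_coord_continuous i : continuous (fst_coord i).
Proof.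
move=> z; apply: (@continuous_comp _ _ _ fst (fun u : 'rV[R]_n => u 0 i)).
  exact: cvg_fst.
exact: coord_continuous.
Qed.

Lemma snd_coord_continuous i : continuous (snd_coord i).
Proof.
move=> z; apply: (@continuous_comp _ _ _ snd (fun u : 'rV[R]_n => u 0 i)).
  exact: cvg_snd.
exact: coord_continuous.
Qed.

End Coordinates.

Lemma is_derive_linear (R : realType) (V W : normedModType R)
    (L : {linear V -> W}) (x v : V) :
  continuous L -> is_derive x v L (L v).
Proof.
move=> cL; have dL : differentiable L x by exact: linear_differentiable.
by apply: DeriveDef; [exact: diff_derivable|rewrite deriveE ?diff_lin].
Qed.

(** * The Funk metric *)

Section Funk.
Variables (R : realType) (n : nat) (Omega : set 'rV[R]_n) (xo : 'rV[R]_n)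
  (phi : 'rV[R]_n -> R).
Hypotheses (oO : open Omega) (cO : connected Omega) (Oxo : Omega xo)
  (mphi : minkowski_norm phi)
  (bO : [set x - xo | x in boundary Omega] = phi @^-1` [set 1]).
Implicit Types (x y p : 'rV[R]_n) (z d : 'rV[R]_n * 'rV[R]_n) (f g : R).

Local Notation F := (fun z => funk_metric Omega z.1 z.2).
Local Notation slit := (slit_tangent Omega).

Lemma boundaryE x : boundary Omega x <-> phi (x - xo) = 1.
Proof.
have -> : (phi (x - xo) = 1) = (phi @^-1` [set 1]) (x - xo) by [].
rewrite -bO; split=> [bx|[x' bx' /addIr <- //]].
by exists x.
Qed.

(** Omega avoids its boundary phi = 1, so its part where phi < 1 is also its
    part where phi <= 1: it is open and closed in Omega, and contains xo. *)
Lemma gauge_lt1 x : Omega x -> phi (x - xo) < 1.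
Proof.
pose gauge x := phi (x - xo).
have cg : continuous gauge.
  move=> y; apply: (@continuous_comp _ _ _ (fun x => x - xo) phi).
    by apply: (cvgB (F := nbhs y)); [exact: cvg_id|exact: cvg_cst].
  exact: minkowski_continuous.
suff <- : Omega `&` [set x | gauge x < 1] = Omega by case.
apply: cO.
- by exists xo; split => //=; rewrite /gauge subrr minkowski0.
- exists [set x | gauge x < 1] => //.
  apply: (@open_comp _ _ gauge [set x : R | x < 1]); last exact: open_lt.
  by move=> y _; exact: cg.
- exists [set x | gauge x <= 1].
    apply: (@closed_comp _ _ gauge [set x : R | x <= 1]); last exact: closed_le.
    by move=> y _; exact: cg.
  apply/seteqP; split=> y [Oy /=]; first by move=> /ltW.
  rewrite le_eqVlt => /orP[/eqP g1|//]; have [_] : boundary Omega y.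
    exact/boundaryE.
  by rewrite (interior_id _).1.
Qed.

(** As phi p < 1, increasing f to g raises phi (f *: p + y) by less than g - f.
    This settles uniqueness of the root, and on which side of it a given f
    lies. *)
Lemma chord_lt p y f g : phi p < 1 -> phi (f *: p + y) <= f -> f < g ->
  phi (g *: p + y) < g.
Proof.
move=> p1 pf fg.
have -> : g *: p + y = (f *: p + y) + (g - f) *: p.
  by rewrite addrAC -scalerDl addrCA subrr addr0.
apply: le_lt_trans (minkowski_triangle mphi _ _) _.
rewrite (minkowskiZ mphi) ?subr_gt0 //; nra.
Qed.

Lemma chord_unique p y f g : phi p < 1 ->
  phi (f *: p + y) = f -> phi (g *: p + y) = g -> f = g.
Proof.
move=> p1 pf pg; have [fg|gf|//] := ltgtP f g.
  by have := chord_lt p1 (y := y) _ fg; rewrite pf pg lexx ltxx => /(_ isT).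
by have := chord_lt p1 (y := y) _ gf; rewrite pf pg lexx ltxx => /(_ isT).
Qed.

(** Intermediate value theorem for f - phi (f *: p + y) between 0 and the point
    M where the triangle inequality makes it nonnegative. *)
Lemma chord_exists p y : phi p < 1 -> y != 0 ->
  exists2 f, 0 < f & phi (f *: p + y) = f.
Proof.
move=> p1 y0; have phiy := minkowski_gt0 mphi y0.
pose M := phi y / (1 - phi p).
have p1' : 0 < 1 - phi p by rewrite subr_gt0.
have M0 : 0 < M by rewrite divr_gt0.
pose psi f := f - phi (f *: p + y).
have psi0 : psi 0 < 0 by rewrite /psi scale0r !add0r oppr_lt0.
have psiM : 0 <= psi M.
  rewrite subr_ge0; apply: le_trans (minkowski_triangle mphi _ _) _.
  have MM : M * (1 - phi p) = phi y by rewrite /M divfK // gt_eqF.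
  by rewrite (minkowskiZ mphi) //; lra.
have cpsi : continuous psi.
  move=> f; apply: cvgB; first exact: cvg_id.
  apply: (@continuous_comp _ _ _ (fun f : R => f *: p + y) phi).
    by apply: cvgD; [apply: cvgZr_tmp; exact: cvg_id|exact: cvg_cst].
  exact: minkowski_continuous.
have [||f] := @IVT _ psi 0 M 0 (ltW M0).
- exact: continuous_subspaceT.
- by rewrite ge_min le_max (ltW psi0) psiM orbT.
rewrite in_itv /= => /andP[f0 _] psif; exists f; last first.
  by apply/esym/eqP; rewrite -subr_eq0 -/(psi f) psif.
rewrite lt_neqAle f0 andbT; apply: contraTneq psi0 => f0E.
by rewrite -f0E in psif; rewrite psif ltxx.
Qed.

Lemma boundary_chord x y f : 0 < f ->
  boundary Omega (x + f^-1 *: y) <-> phi (f *: (x - xo) + y) = f.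
Proof.
move=> f0; rewrite boundaryE.
have -> : f *: (x - xo) + y = f *: (x + f^-1 *: y - xo).
  by rewrite addrAC [RHS]scalerDr scalerA mulfV ?gt_eqF // scale1r.
rewrite (minkowskiZ mphi) //; split=> [->|]; first by rewrite mulr1.
by move=> E; apply: (mulfI (lt0r_neq0 f0)); rewrite E mulr1.
Qed.

Lemma funk_metricP x y : Omega x -> y != 0 ->
  0 < funk_metric Omega x y /\
  phi (funk_metric Omega x y *: (x - xo) + y) = funk_metric Omega x y.
Proof.
move=> Ox y0; have [f f0 pf] := chord_exists (gauge_lt1 Ox) y0.
rewrite /funk_metric (negbTE y0); case: xgetP => [g -> [g0 /boundary_chord]|].
  by move=> /(_ g0).
by move=> /(_ f) []; split=> //; exact/boundary_chord.
Qed.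

Lemma funk_metric_unique x y f : Omega x -> y != 0 ->
  phi (f *: (x - xo) + y) = f -> funk_metric Omega x y = f.
Proof.
move=> Ox y0 pf; have [_ pF] := funk_metricP Ox y0.
exact: chord_unique (gauge_lt1 Ox) pF pf.
Qed.

Lemma funk_metricZ x y l : Omega x -> 0 < l ->
  funk_metric Omega x (l *: y) = l * funk_metric Omega x y.
Proof.
move=> Ox l0; have [->|y0] := eqVneq y 0.
  by rewrite scaler0 /funk_metric eqxx mulr0.
apply: funk_metric_unique => //; first by rewrite scaler_eq0 negb_or gt_eqF.
by rewrite -scalerA -scalerDr (minkowskiZ mphi) // (funk_metricP Ox y0).2.
Qed.

(** F times the vector from xo to the point where the ray from z.1 in direction
    z.2 leaves Omega. Unlike the exit point, it depends on z only through F and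
    products, and phi takes the value F on it. *)
Definition scaled_exit z := F z *: (z.1 - xo) + z.2.
Local Notation w := scaled_exit.

Lemma open_slit : open slit.
Proof.
rewrite openE => z [Oz z0]; near=> z'; split; near: z'.
  by apply: (@cvg_fst _ _ (nbhs z.1) (nbhs z.2)); exact: open_nbhs_nbhs.
apply: (@cvgr_neq0 _ _ _ (nbhs z) _ snd z.2) => //; exact: cvg_snd.
Unshelve. all: by end_near. Qed.

Lemma funk_gt0 z : slit z -> 0 < F z.
Proof. by case=> Oz z0; exact: (funk_metricP Oz z0).1. Qed.

Lemma scaled_exitE z : slit z -> phi (w z) = F z.
Proof. by case=> Oz z0; exact: (funk_metricP Oz z0).2. Qed.

Lemma scaled_exit_neq0 z : slit z -> w z != 0.
Proof.
move=> sz; apply: contraTneq (funk_gt0 sz) => wz.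
by rewrite -(scaled_exitE sz) wz minkowski0 // ltxx.
Qed.

(** The ray meets the boundary transversally: this is what makes the implicit
    equation for F nondegenerate. *)
Lemma exit_transversal z : slit z -> 'D_(z.1 - xo) phi (w z) < 1.
Proof.
move=> sz; apply: le_lt_trans (gauge_lt1 sz.1).
exact/minkowski_derive_le/scaled_exit_neq0.
Qed.

Lemma chord_continuous f z :
  {for z, continuous (fun z => phi (f *: (z.1 - xo) + z.2))}.
Proof.
apply: (@continuous_comp _ _ _ (fun z => f *: (z.1 - xo) + z.2) phi).
  apply: (@cvgD _ _ _ (nbhs z)); last exact: cvg_snd.
  apply: cvgZl_tmp; apply: (@cvgB _ _ _ (nbhs z)); last exact: cvg_cst.
  exact: cvg_fst.
exact: minkowski_continuous.
Qed.

(** For a < F z < b, the strict inequalities a < phi (a *: p + y) and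
    phi (b *: p + y) < b persist near z, where they locate F between a and
    b. *)
Lemma funk_continuous z : slit z -> {for z, continuous F}.
Proof.
move=> sz; have F0 := funk_gt0 sz; have p1 := gauge_lt1 sz.1.
apply/(@cvgrPdist_lt _ _ _ (nbhs z)) => e e0 /=.
pose a := F z - e.
have aF : a < F z by rewrite ltrBlDr ltrDl.
have ha : a < phi (a *: (z.1 - xo) + z.2).
  rewrite ltNge; apply/negP => aphi; have := chord_lt p1 aphi aF.
  by rewrite -/(w z) scaled_exitE // ltxx.
have hb : phi ((F z + e) *: (z.1 - xo) + z.2) < F z + e.
  apply: (@chord_lt _ _ (F z)) => //; last by rewrite ltrDl.
  by rewrite -/(w z) scaled_exitE.
near=> z'.
have sz' : slit z' by near: z'; exact: (open_nbhs_nbhs (conj open_slit sz)).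
have p1' := gauge_lt1 sz'.1.
have ha' : a < phi (a *: (z'.1 - xo) + z'.2).
  by near: z'; exact: (cvgr_gt _ (@chord_continuous a z)).
have hb' : phi ((F z + e) *: (z'.1 - xo) + z'.2) < F z + e.
  by near: z'; exact: (cvgr_lt _ (@chord_continuous _ z)).
have Fe := scaled_exitE sz'.
have aF' : a < F z'.
  rewrite ltNge le_eqVlt; apply/negP => /orP[/eqP E|Fa].
    by move: ha'; rewrite -E -/(w z') Fe ltxx.
  have := chord_lt (y := z'.2) p1' _ Fa.
  by rewrite -/(w z') Fe lexx => /(_ isT); rewrite ltNge (ltW ha').
have Fb' : F z' < F z + e.
  rewrite ltNge le_eqVlt; apply/negP => /orP[/eqP E|Fb].
    by move: hb'; rewrite E -/(w z') Fe ltxx.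
  by have := chord_lt p1' (ltW hb') Fb; rewrite -/(w z') Fe ltxx.
move: aF' Fb'; rewrite /a; move: (F z) (F z') => r r' ra rb.
by rewrite ltr_distlC ra rb.
Unshelve. all: by end_near. Qed.

Lemma funk_differentiable z : slit z -> differentiable F z.
Proof.
move=> sz.
pose chord (t : ('rV[R]_n * 'rV[R]_n) * R) := t.2 *: (t.1.1 - xo) + t.1.2.
have chord_line s : chord ((z, F z) + s *: (0, 1)) = w z + s *: (z.1 - xo).
  rewrite /chord /w /= !scaler0 !addr0 [_ *: 1]mulr1 scalerDl.
  by rewrite addrAC.
have dfst : differentiable
    (@fst ('rV[R]_n * 'rV[R]_n) R) (z, F z).
  by apply: linear_differentiable => t; exact: cvg_fst.
have dsnd : differentiable (@snd ('rV[R]_n * 'rV[R]_n) R) (z, F z).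
  by apply: linear_differentiable => t; exact: cvg_snd.
have dchord : differentiable chord (z, F z).
  apply: differentiable_row => i.
  have -> : (fun t => chord t 0 i) = snd * ((fst_coord i \o fst) - cst (xo 0 i))
                                     + (snd_coord i \o fst).
    by apply/funext => t; rewrite /chord !mxE.
  apply: differentiableD; last first.
    apply: differentiable_comp; first exact: dfst.
    exact/linear_differentiable/snd_coord_continuous.
  apply: differentiableM; first exact: dsnd.
  apply: differentiableB; last exact: differentiable_cst.
  apply: differentiable_comp; first exact: dfst.
  exact/linear_differentiable/fst_coord_continuous.
have wz0 := scaled_exit_neq0 sz.
apply: (@implicit_differentiable _ _ (fun t => phi (chord t) - t.2)).
- exact: funk_continuous.
- apply: (near_open open_slit sz) => z' sz' /=.
  by rewrite /chord /= -/(w z') scaled_exitE // subrr.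
- apply: differentiableB; last exact: dsnd.
  exact: differentiable_comp dchord (minkowski_differentiable mphi wz0).
- have wz1 : w z + 0 *: (z.1 - xo) != 0 by rewrite scale0r addr0.
  have D1 := is_derive_line (minkowski_differentiable mphi wz1).
  have DP : is_derive (0 : R) 1
      (fun s : R => phi (w z + s *: (z.1 - xo)) - (F z + s))
      ('D_(z.1 - xo) phi (w z) - 1).
    apply: is_derive_eq.
    by rewrite add0r scale0r addr0.
  suff -> : 'D_(0, 1) (fun t => phi (chord t) - t.2) (z, F z) =
            'D_(z.1 - xo) phi (w z) - 1.
    by rewrite subr_eq0 lt_eqF // exit_transversal.
  apply: near_derive_line DP; near=> s.
  by rewrite chord_line /= [_ *: 1]mulr1.
Unshelve. all: by end_near. Qed.


Lemma is_derive_scaled_exit_coord i z d : slit z ->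
  is_derive z d (fun z => w z 0 i)
    (('D_d F z *: (z.1 - xo) + (F z *: d.1 + d.2)) 0 i).
Proof.
move=> sz.
have -> : (fun z => w z 0 i) = F * (fst_coord i - cst (xo 0 i)) + snd_coord i.
  by apply/funext => t; rewrite /scaled_exit !mxE.
have dF : is_derive z d F ('D_d F z).
  exact/derivableP/diff_derivable/funk_differentiable.
have d1 := is_derive_linear z d (@fst_coord_continuous R n i).
have d2 := is_derive_linear z d (@snd_coord_continuous R n i).
apply: is_derive_eq.
rewrite subr0 !mxE addrA; congr (_ + _).
by rewrite addrC; congr (_ + _); exact: mulrC.
Qed.

Lemma scaled_exit_differentiable z : slit z -> differentiable w z.
Proof.
move=> sz; apply: differentiable_row => i.
have -> : (fun z => w z 0 i) = F * (fst_coord i - cst (xo 0 i)) + snd_coord i.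
  by apply/funext => t; rewrite /scaled_exit !mxE.
apply: differentiableD; last exact/linear_differentiable/snd_coord_continuous.
apply: differentiableM; first exact: funk_differentiable.
apply: differentiableB; last exact: differentiable_cst.
exact/linear_differentiable/fst_coord_continuous.
Qed.

Lemma derive_scaled_exit z d : slit z ->
  'D_d w z = 'D_d F z *: (z.1 - xo) + (F z *: d.1 + d.2).
Proof.
move=> sz; rewrite derive_mx;
  last exact/diff_derivable/scaled_exit_differentiable.
apply/rowP => i; rewrite mxE.
have D := is_derive_scaled_exit_coord i d sz.
by rewrite (@derive_val _ _ _ _ _ _ _ D).
Qed.

(** Differentiate F = phi \o w, where w itself depends on F. *)
Lemma derive_funk_eq z d : slit z ->
  'D_d F z * (1 - 'D_(z.1 - xo) phi (w z)) = 'D_(F z *: d.1 + d.2) phi (w z).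
Proof.
move=> sz; have w0 := scaled_exit_neq0 sz.
have E : 'D_d F z = 'D_d (phi \o w) z.
  by apply: near_eq_derive; apply: (near_open open_slit sz) => z' /scaled_exitE.
have := derive_comp d (scaled_exit_differentiable sz)
  (minkowski_differentiable mphi w0).
rewrite -E (derive_scaled_exit d sz).
have -> := minkowski_deriveD mphi ('D_d F z *: (z.1 - xo))
  (F z *: d.1 + d.2) w0.
rewrite (minkowski_deriveZ mphi ('D_d F z) (z.1 - xo) w0) => DF.
by rewrite mulrBr mulr1 {1}DF addrAC subrr add0r.
Qed.

Lemma derive_funk z d : slit z ->
  'D_d F z = 'D_(F z *: d.1 + d.2) phi (w z) / (1 - 'D_(z.1 - xo) phi (w z)).
Proof.
move=> sz; rewrite -derive_funk_eq // mulfK // subr_eq0 gt_eqF //.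
exact: exit_transversal.
Qed.

(** The formula of [derive_funk] expresses the derivatives of F through F, the
    coordinates and the derivatives of phi at w, so F gains one order of
    differentiability at each step. *)
Lemma funk_Ck k : Ck_on k slit F.
Proof.
have oS := open_slit.
elim: k => [|k IH]; first by move=> z; exact: funk_continuous.
have C1 i : Ck_on k slit (fst_coord i).
  by apply: Ck_on_linear => //; exact: fst_coord_continuous.
have C2 i : Ck_on k slit (snd_coord i).
  by apply: Ck_on_linear => //; exact: snd_coord_continuous.
have Cp i : Ck_on k slit (fun z => (z.1 - xo) 0 i).
  apply: eq_Ck_on (Ck_on_add oS (C1 i) (Ck_on_cst oS k (- xo 0 i))) => // z _.
  by rewrite !mxE.
have Cw i : Ck_on k slit (fun z => w z 0 i).
  apply: eq_Ck_on (Ck_on_add oS (Ck_on_mul oS IH (Cp i)) (C2 i)) => // z _.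
  by rewrite /scaled_exit !mxE.
have Cphi i : Ck_on k slit ('D_(delta_mx 0 i) phi \o w).
  apply: (@Ck_on_comp _ _ _ _ [set y | y != 0]) => //.
    exact: scaled_exit_neq0.
  by have [_] := minkowski_smooth mphi k.+1; exact.
have Cd (u : 'rV[R]_n * 'rV[R]_n -> 'rV[R]_n) :
    (forall i, Ck_on k slit (fun z => u z 0 i)) ->
    Ck_on k slit (fun z => 'D_(u z) phi (w z)).
  move=> Cu; have := Ck_on_sum oS (fun i => Ck_on_mul oS (Cu i) (Cphi i)).
  apply: eq_Ck_on => // z sz; rewrite derive_row //.
  exact/minkowski_differentiable/scaled_exit_neq0.
split=> [z|d]; first exact: funk_differentiable.
have Cnum : Ck_on k slit (fun z => 'D_(F z *: d.1 + d.2) phi (w z)).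
  apply: Cd => i.
  have := Ck_on_add oS (Ck_on_mul oS IH (Ck_on_cst oS k (d.1 0 i)))
    (Ck_on_cst oS k (d.2 0 i)).
  by apply: eq_Ck_on => // z _; rewrite !mxE.
have Cden := Ck_on_add oS (Ck_on_cst oS k 1) (Ck_on_opp oS (Cd _ Cp)).
have den0 z : slit z -> 1 - 'D_(z.1 - xo) phi (w z) != 0.
  by move=> sz; rewrite subr_eq0 gt_eqF // exit_transversal.
have := Ck_on_mul oS Cnum (Ck_on_inv oS den0 Cden).
by apply: eq_Ck_on => // z sz; rewrite derive_funk.
Qed.

(** * The curvature of the spray *)

Local Notation G := (spray_coef (funk_spray Omega)).

Lemma spray_coefE i : G i = F * snd_coord i.
Proof.
apply/funext => z; rewrite /spray_coef /funk_spray /snd_coord /= !mxE.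
by rewrite !mulNr mulrN opprK -mulrA mulKf.
Qed.

Lemma spray_coef_Ck k i : Ck_on k slit (G i).
Proof.
rewrite spray_coefE; apply: (Ck_on_mul open_slit (funk_Ck k)).
apply: Ck_on_linear; first exact: open_slit.
exact: snd_coord_continuous.
Qed.

Lemma spray_coef_differentiable i z : slit z -> differentiable (G i) z.
Proof. by have [+ _] := spray_coef_Ck 1 i; exact. Qed.

Lemma dy_spray_coef_differentiable k i z :
  slit z -> differentiable (dy k (G i)) z.
Proof.
by have [_ /(_ (0, delta_mx 0 k)) [+ _]] := spray_coef_Ck 2 i; exact.
Qed.

Lemma derive_spray_coef i z d : slit z ->
  'D_d (G i) z = 'D_d F z * z.2 0 i + F z * d.2 0 i.
Proof.
move=> sz; rewrite spray_coefE.
have dF : is_derive z d F ('D_d F z).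
  exact/derivableP/diff_derivable/funk_differentiable.
have d2 := is_derive_linear z d (@snd_coord_continuous R n i).
by rewrite derive_val addrC; congr (_ + _); exact: mulrC.
Qed.

(** Euler's relation at w = F p + y, where phi takes the value F. *)
Lemma derive_exit_velocity z : slit z ->
  'D_(z.2) phi (w z) = F z * (1 - 'D_(z.1 - xo) phi (w z)).
Proof.
move=> sz; have w0 := scaled_exit_neq0 sz.
have := minkowski_euler mphi w0; rewrite scaled_exitE // {1}/scaled_exit.
rewrite (minkowski_deriveD mphi (F z *: (z.1 - xo)) z.2 w0).
rewrite (minkowski_deriveZ mphi _ _ w0) => E.
by rewrite mulrBr mulr1 -{1}E addrAC subrr add0r.
Qed.

Lemma derive_funk_fiber z : slit z -> 'D_(0, z.2) F z = F z.
Proof.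
move=> sz; rewrite (derive_funk _ sz) scaler0 add0r derive_exit_velocity //.
by rewrite mulfK // subr_eq0 gt_eqF // exit_transversal.
Qed.

Lemma dy_funk k z : slit z ->
  dy k F z = 'D_(delta_mx 0 k) phi (w z) / (1 - 'D_(z.1 - xo) phi (w z)).
Proof. by move=> sz; rewrite /dy (derive_funk _ sz) scaler0 add0r. Qed.

(** In [derive_funk], a horizontal direction u enters as F u and a vertical one
    as u. *)
Lemma okada z u : slit z -> 'D_(u, 0) F z = F z * 'D_(0, u) F z.
Proof.
move=> sz; have w0 := scaled_exit_neq0 sz.
rewrite (derive_funk _ sz) (derive_funk _ sz) /= scaler0 add0r addr0.
by rewrite (minkowski_deriveZ mphi _ _ w0) mulrA.
Qed.

Lemma dy_spray_coef k i z : slit z ->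
  dy k (G i) z = dy k F z * z.2 0 i + F z * (i == k)%:R.
Proof. by move=> sz; rewrite {1}/dy (derive_spray_coef _ _ sz) /= mxE eqxx. Qed.

(** Rescaling y rescales w and leaves dphi_w unchanged, so the derivative of
    F y^i in y is 1-homogeneous in y. *)
Lemma dy_spray_coef_fiber i k z : slit z ->
  'D_(0, z.2) (dy k (G i)) z = dy k (G i) z.
Proof.
move=> sz; have w0 := scaled_exit_neq0 sz; set h := dy k (G i) z.
have dc : is_derive (0 : R) 1 (fun s : R => s * h + h) h.
  by apply: is_derive_eq; rewrite addr0 scaler0 add0r [_ *: _]mulr1.
apply: near_derive_line dc; near=> s.
have s1 : 0 < s + 1.
  by rewrite -ltrBlDr sub0r; near: s; apply: lt_nbhsr; rewrite oppr_lt0.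
have -> : z + s *: (0, z.2) = (z.1, (s + 1) *: z.2).
  rewrite [LHS]surjective_pairing /= scaler0 addr0.
  by rewrite scalerDl scale1r addrC.
have sz' : slit (z.1, (s + 1) *: z.2).
  by split; rewrite /= ?scaler_eq0 ?negb_or ?gt_eqF ?sz.2 //; exact: sz.1.
have w' : w (z.1, (s + 1) *: z.2) = (s + 1) *: w z.
  rewrite -[LHS]/(funk_metric Omega z.1 ((s + 1) *: z.2) *: (z.1 - xo)
                  + (s + 1) *: z.2).
  by rewrite (funk_metricZ _ sz.1 s1) -scalerA -scalerDr.
rewrite /h !dy_spray_coef // !dy_funk // w' /=.
rewrite !(minkowski_derive_scale mphi) // (funk_metricZ _ sz.1 s1) mxE.
ring.
Unshelve. all: by end_near. Qed.

(** The exit point of the chord through x in direction y is also that of the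
    chord through x + s y. The equation phi (f p + y) = f has therefore the
    root F / (1 - s F) at x + s y, and w is divided by 1 - s F. *)
Lemma scaled_exit_along z s : 1 - s * F z != 0 ->
  (F z / (1 - s * F z)) *: ((z + s *: (z.2, 0)).1 - xo) + (z + s *: (z.2, 0)).2
  = (1 - s * F z)^-1 *: w z.
Proof.
set a := (1 - s * F z)^-1 => s0.
have a1 : a = F z * a * s + 1.
  by rewrite /a; field.
have -> : (z + s *: (z.2, 0)).2 = z.2 by rewrite /= scaler0 addr0.
have -> : (z + s *: (z.2, 0)).1 - xo = (z.1 - xo) + s *: z.2 by rewrite addrAC.
rewrite /scaled_exit !scalerDr !scalerA -addrA -[X in _ + (_ + X)]scale1r.
by rewrite -scalerDl -a1 [a * _]mulrC.
Qed.

Lemma funk_geodesic z s : slit z -> slit (z + s *: (z.2, 0)) ->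
  0 < 1 - s * F z -> F (z + s *: (z.2, 0)) = F z / (1 - s * F z).
Proof.
move=> sz sz' s0; apply: funk_metric_unique; [exact: sz'.1|exact: sz'.2|].
rewrite scaled_exit_along ?gt_eqF // (minkowskiZ mphi) ?invr_gt0 //.
by rewrite scaled_exitE // mulrC.
Qed.

Lemma scaled_exit_geodesic z s : slit z -> slit (z + s *: (z.2, 0)) ->
  0 < 1 - s * F z -> w (z + s *: (z.2, 0)) = (1 - s * F z)^-1 *: w z.
Proof.
move=> sz sz' s0; rewrite -scaled_exit_along ?gt_eqF //.
by rewrite {1}/scaled_exit funk_geodesic.
Qed.

(** Along the chord, s |-> H s * (1 - s F) is constant, since dphi_w does not
    change and 1 - dphi_w (p + s y) = (1 - dphi_w (p)) (1 - s F). *)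
Lemma dy_spray_coef_geodesic i k z : slit z ->
  'D_(z.2, 0) (dy k (G i)) z = F z * dy k (G i) z.
Proof.
move=> sz; have w0 := scaled_exit_neq0 sz.
pose H s := dy k (G i) (z + s *: (z.2, 0)).
have E : \forall s \near 0, H s * (1 - s * F z) = dy k (G i) z.
  near=> s.
  have s1 : 0 < 1 - s * F z.
    near: s; apply: (@cvgr_gt _ _ (nbhs (0 : R)) _ _ 1) => //.
    have := @cvg_line R R 1 (- F z).
    by under eq_fun do rewrite -[_ *: _]/(_ * _) mulrN.
  have sz' : slit (z + s *: (z.2, 0)).
    near: s; apply: (@cvg_line R _ z (z.2, 0)).
    exact: (open_nbhs_nbhs (conj open_slit sz)).
  have den0 : 1 - 'D_(z.1 - xo) phi (w z) != 0.
    by rewrite subr_eq0 gt_eqF // exit_transversal.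
  rewrite /H !dy_spray_coef // !dy_funk // funk_geodesic //.
  rewrite scaled_exit_geodesic //.
  rewrite !(minkowski_derive_scale mphi) ?invr_gt0 //.
  have -> : (z + s *: (z.2, 0)).1 - xo = (z.1 - xo) + s *: z.2.
    by rewrite addrAC.
  rewrite (minkowski_deriveD mphi (z.1 - xo) (s *: z.2) w0).
  rewrite (minkowski_deriveZ mphi _ _ w0) derive_exit_velocity //.
  have -> : (z + s *: (z.2, 0)).2 = z.2 by rewrite /= scaler0 addr0.
  have -> : 1 - ('D_(z.1 - xo) phi (w z) +
      s * (F z * (1 - 'D_(z.1 - xo) phi (w z)))) =
      (1 - 'D_(z.1 - xo) phi (w z)) * (1 - s * F z) by ring.
  by field; rewrite den0 gt_eqF.
have z0 : z + 0 *: (z.2, 0) = z by rewrite scale0r addr0.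
have dz : differentiable (dy k (G i)) (z + 0 *: (z.2, 0)).
  by rewrite z0; exact: dy_spray_coef_differentiable.
have DH : is_derive (0 : R) 1 H ('D_(z.2, 0) (dy k (G i)) z).
  by have := is_derive_line dz; rewrite z0.
have DP : is_derive (0 : R) 1 (fun s : R => H s * (1 - s * F z))
    ('D_(z.2, 0) (dy k (G i)) z - F z * dy k (G i) z).
  apply: is_derive_eq.
  by rewrite {1}/H z0 /GRing.scale /=; ring.
apply/eqP; rewrite -subr_eq0 -(@derive_val _ _ _ _ _ _ _ DP).
by rewrite (near_eq_derive _ E) derive_cst.
Unshelve. all: by end_near. Qed.

Lemma derive_fst_sum (f : 'rV[R]_n * 'rV[R]_n -> R) z (u : 'rV[R]_n) :
  differentiable f z ->
  \sum_j u 0 j * dx j f z = 'D_(u, 0) f z.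
Proof.
move=> df; rewrite deriveE //.
have -> : (u, 0) = \sum_j u 0 j *: (delta_mx 0 j, 0) :> ('rV[R]_n * 'rV[R]_n).
  rewrite [RHS]surjective_pairing !linear_sum /=; congr (_, _).
    exact: row_sum_delta.
  by rewrite big1 // => j _; rewrite scaler0.
by rewrite linear_sum; apply: eq_bigr => j _; rewrite linearZ /dx deriveE.
Qed.

Lemma derive_snd_sum (f : 'rV[R]_n * 'rV[R]_n -> R) z (u : 'rV[R]_n) :
  differentiable f z ->
  \sum_j u 0 j * dy j f z = 'D_(0, u) f z.
Proof.
move=> df; rewrite deriveE //.
have -> : (0, u) = \sum_j u 0 j *: (0, delta_mx 0 j) :> ('rV[R]_n * 'rV[R]_n).
  rewrite [RHS]surjective_pairing !linear_sum /=; congr (_, _).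
    by rewrite big1 // => j _; rewrite scaler0.
  exact: row_sum_delta.
by rewrite linear_sum; apply: eq_bigr => j _; rewrite linearZ /dy deriveE.
Qed.

Lemma funk_spray_R_flat : R_flat Omega (funk_spray Omega).
Proof.
move=> z sz i k; rewrite /riemann_curvature; cbv zeta.
have dG := spray_coef_differentiable i sz.
have dH := dy_spray_coef_differentiable k i sz.
set S1 := (X in _ - X + _ - _); set S2 := (X in _ + 2 * X - _).
set S3 := (X in _ + _ - X).
have -> : S1 = F z * dy k (G i) z.
  by rewrite -(dy_spray_coef_geodesic _ _ sz); exact: derive_fst_sum.
have -> : S2 = F z * dy k (G i) z.
  rewrite -(dy_spray_coef_fiber _ _ sz) -(derive_snd_sum _ dH) mulr_sumr.
  by apply: eq_bigr => j _; rewrite spray_coefE mulrA.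
have -> : S3 = dy k F z * 'D_(0, z.2) (G i) z + F z * dy k (G i) z.
  (* dy k (G j) z is the j-th coordinate of F_k y + F e_k. *)
  have <- : 'D_(0, dy k F z *: z.2 + F z *: delta_mx 0 k) (G i) z =
      dy k F z * 'D_(0, z.2) (G i) z + F z * dy k (G i) z.
    rewrite (deriveE _ dG) (deriveE _ dG) /dy (deriveE _ dG).
    have -> : (0, 'D_(0, delta_mx 0 k) F z *: z.2 + F z *: delta_mx 0 k) =
       'D_(0, delta_mx 0 k) F z *: (0, z.2) + F z *: (0, delta_mx 0 k)
       :> ('rV[R]_n * 'rV[R]_n).
      by congr (_, _); rewrite /= !scaler0 addr0.
    by rewrite linearD !linearZ.
  rewrite -(derive_snd_sum _ dG); apply: eq_bigr => j _.
  by rewrite mulrC dy_spray_coef // !mxE eqxx.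
rewrite /dx !(derive_spray_coef _ _ sz) derive_funk_fiber // okada //.
rewrite -/(dy k F z) dy_spray_coef //=.
by rewrite !mxE; ring.
Qed.

Lemma funk_spray_is_spray : is_spray Omega (funk_spray Omega).
Proof.
split=> [x y _ //|i k|i l x y Ox l0]; first exact: spray_coef_Ck.
rewrite spray_coefE.
rewrite -[LHS]/(funk_metric Omega x (l *: y) * (l *: y) 0 i).
rewrite -[RHS]/(l ^+ 2 * (funk_metric Omega x y * y 0 i)).
by rewrite funk_metricZ // mxE; ring.
Qed.

End Funk.

Theorem theorem1p1 (R : realType) (n : nat) (Omega : set 'rV[R]_n)
    (hOmega : strongly_convex_domain Omega) :
  is_spray Omega (funk_spray Omega) /\ R_flat Omega (funk_spray Omega).
Proof.
have [oO cO [xo [phi [Oxo mphi bO]]]] := hOmega; split.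
  exact: funk_spray_is_spray bO.
exact: funk_spray_R_flat bO.
Qed.
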